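(* Let $n\ge 4$ be an even integer. Then $G_n$ is a maximal independent set in $\mathrm{Sym}(n)$; that is, $G_n$ is an independent set of $G(\Omega_n)$ and $G_n\cup\{\tau\}$ is not an independent set for any $\tau\in\mathrm{Sym}(n)\setminus G_n$.
   Context: Elements of the symmetric group $\mathrm{Sym}(m)$ are identified with $m\times m$ permutation matrices: $\sigma$ corresponds to the matrix $P$ with $P_{ij}=1$ if $j=\sigma(i)$ and $P_{ij}=0$ otherwise. The Birkhoff polytope graph $G(\Omega_n)$ has vertex set $\mathrm{Sym}(n)$, and $\sigma_1,\sigma_2$ are adjacent iff $\sigma_1^{-1}\sigma_2$ is a single cycle of length $>1$ (exactly one nontrivial cycle in its disjoint cycle decomposition). An independent set is a set of pairwise nonadjacent vertices. For even $n=2k\ge 4$, let $H_n=\{P\oplus P:P\in\mathrm{Sym}(k)\}$ (block diagonal matrices with two equal $k\times k$ permutation matrix blocks), let $K_n$ be the group of matrices $\begin{bmatrix} I_k-D & D\\ D & I_k-D\end{bmatrix}$ with $D$ a $k\times k$ diagonal $0$-$1$ matrix of even trace, and let $G_n=H_nK_n=\{hk:h\in H_n,\ k\in K_n\}$, which is a subgroup of $\mathrm{Sym}(n)$. Equivalently, $G_n$ is the group of all even permutations of $\{1,\dots,n\}$ that preserve the partition of $\{1,\dots,n\}$ into the pairs $\{j,j+k\}$, $1\le j\le k$. *)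

(* Defs.v *)
From HB Require Import structures.
From mathcomp Require Import all_boot all_order all_algebra all_fingroup.

Set Implicit Arguments.
Unset Strict Implicit.
Unset Printing Implicit Defensive.

Import GRing.Theory.

Definition independent (T : finType) (e : rel T) (A : {set T}) : Prop :=
  {in A &, forall x y, x != y -> ~~ e x y}.

Definition maximal_independent (T : finType) (e : rel T) (A : {set T}) : Prop :=
  independent e A /\ forall t, t \notin A -> ~ independent e (t |: A).

(* [porbits s] contains the fixed points of [s] as singletons. *)
Definition single_cycle (T : finType) (s : {perm T}) : bool :=
  #|[set C in porbits s | 1 < #|C|]| == 1.

Definition birkhoff_adj (n : nat) : rel 'S_n :=
  fun s t => single_cycle (s^-1 * t)%g.

(* Below, n = k + k.  [perm_mx s i j] is 1 iff [s i = j], and products in ['S_n]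
   compose left to right, so [perm_mx] is multiplicative in the order of the
   factors. *)
Definition birkhoffH (k : nat) : {set 'S_(k + k)} :=
  [set s | [exists p : 'S_k, perm_mx s ==
     block_mx (perm_mx p) 0%R 0%R (perm_mx p) :> 'M[int]_(k + k)]].

Definition diag01 (k : nat) (d : 'rV[bool]_k) : 'M[int]_k :=
  diag_mx (map_mx (fun b : bool => (b%:R)%R) d).

Definition birkhoffK (k : nat) : {set 'S_(k + k)} :=
  [set s | [exists d : 'rV[bool]_k, let D := diag01 d in
     (2 %| (\tr D)%R)%Z &&
     (perm_mx s == block_mx (1%:M - D)%R D D (1%:M - D)%R :> 'M[int]_(k + k))]].

Definition birkhoffG (k : nat) : {set 'S_(k + k)} :=
  (birkhoffH k * birkhoffK k)%g.

(* Main.v *)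
Require Import Defs.
From mathcomp Require Import all_boot all_order all_algebra all_fingroup.
From mathcomp Require Import zify.

(** Let [f] be the involution exchanging [j] and [j + k].  Comparing matrices
shows that [birkhoffG k] is the group of even permutations commuting with [f]
([birkhoffGE]).

Independence.  If two distinct elements of the group were adjacent, some element
[g] of the group would be a single cycle.  Its fixed points are permuted by [f],
which moves every point, so they are even in number; hence the cycle has even
length and [g] is odd, a contradiction.

Maximality.  Let [t] lie outside the group.  It is enough to find a single cycle
[h] with [t * h^-1] in the group, that is, a single cycle of the same parity as
[t] with [f ^ h = f ^ t].  If [t] commutes with [f], then [t] is odd and the
transposition of two [f]-partners will do.  Otherwise [f] and [f ^ t] are two
distinct perfect matchings, and [matching_conj_single_cycle] produces single
cycles of both parities carrying the first to the second.

That last result is the heart of the proof.  The union of two perfect matchings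
is made of common edges and alternating circuits.  On one circuit
[v1, v2, ..., v2l], with [f]-edges [v1 v2], [v3 v4], ..., the rotation of all the
vertices carries one matching to the other, and so does the same rotation
skipping [v2]; these cycles have opposite parities.  With several circuits the
rotations must be merged into one cycle.  [matching_conj_cycle] does this by
induction, building a cycle of odd length that skips exactly one vertex of the
union [D] of the circuits: [f] is modified on two of its edges so as to agree
with the other matching at one more edge, and the cycle given by the induction
hypothesis for the modified matching is enlarged by two or four points.
The second parity is then obtained by inserting the skipped vertex. *)

Set Implicit Arguments.
Unset Strict Implicit.
Unset Printing Implicit Defensive.

Import GroupScope.

(** * Single cycles, counted through orbits *)

Section Cycles.
Variable T : finType.
Implicit Types (s h : {perm T}) (S : {set T}).

Lemma porbit_fixed s x : s x = x -> porbit s x = [set x].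
Proof.
move=> sx; apply/setP=> y; rewrite inE; apply/porbitP/eqP => [[i ->]|->].
  by elim: i => [|i IHi]; rewrite ?perm1 // expgSr permM IHi.
by exists 0; rewrite perm1.
Qed.

Lemma card_porbits s :
  #|porbits s| = #|[set C in porbits s | 1 < #|C|]| + #|[set x | s x == x]|.
Proof.
rewrite -(cardsID [set C : {set T} | 1 < #|C|] (porbits s)); congr (_ + _).
  by apply: eq_card => C; rewrite !inE.
rewrite -(card_imset _ (@set1_inj T)); apply: eq_card => C.
rewrite !inE -leqNgt; apply/andP/imsetP => [[C1 /imsetP[x _ defC]]|[x]].
  exists x; last first.
    by apply/esym/eqP; rewrite eqEcard cards1 C1 sub1set andbT defC porbit_id.
  rewrite inE; apply/eqP.
  move: C1; rewrite defC => /card_le1_eqP; apply; first exact: porbit_id.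
  exact: (mem_porbit s 1).
rewrite inE => /eqP sx ->; rewrite cards1; split=> //.
by rewrite -(porbit_fixed sx) imset_f.
Qed.

Lemma single_cycleE s :
  single_cycle s = (#|porbits s| == #|[set x | s x == x]|.+1).
Proof. by rewrite card_porbits -[#|[set x | s x == x]|.+1]add1n eqn_add2r. Qed.

(** The parity of [s] is that of [#|T|] minus the number of its orbits, so a single
cycle is even or odd according to the number of points it fixes. *)
Lemma single_cycle_odd s :
  single_cycle s -> odd_perm s = odd #|T| (+) ~~ odd #|[set x | s x == x]|.
Proof. by rewrite single_cycleE /odd_perm => /eqP->. Qed.

(** [s] permutes [S] cyclically and fixes every other point.  Given the first
condition, the second one says that [S] is a single orbit: the points outside [S]
contribute [#|T| - #|S|] orbits.  This form makes it easy to insert points, since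
the effect of a transposition on the number of orbits is known.  Singletons are
allowed for [S], as the starting point of a chain of insertions. *)
Definition cycle_on S s : Prop :=
  (forall x, x \notin S -> s x = x) /\ #|porbits s| + #|S| = #|T|.+1.

Lemma cycle_on1 x : cycle_on [set x] 1.
Proof.
split=> [y _|]; first by rewrite perm1.
rewrite cards1 addn1; congr _.+1; rewrite -(card_imset predT (@set1_inj T)).
apply: eq_card => C; apply/imsetP/imsetP => -[y _ ->]; exists y => //.
  by rewrite porbit_fixed ?perm1.
by rewrite porbit_fixed ?perm1.
Qed.

(** Multiplying by a transposition that joins two different orbits merges them. *)
Lemma cycle_on_tperm S s x y :
  cycle_on S s -> x \in S -> y \notin S -> cycle_on (y |: S) (tperm x y * s).
Proof.
move=> [fixS cardS] xS yS; split=> [z|].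
  rewrite !inE negb_or => /andP[zy zS]; rewrite permM tpermD ?fixS //.
    by apply: contraNneq zS => <-.
  by rewrite eq_sym.
have xy : x != y by apply: contraNneq yS => <-.
have := porbits_mul_tperm s x y.
rewrite (porbit_fixed (fixS _ yS)) inE xy cardsU1 yS /=.
rewrite -[(true.*2)]/2 => /eqP; rewrite addn1 addn2 eqSS => /eqP E.
by rewrite -cardS -E addSn addnS.
Qed.

Lemma single_cycle_on S s x y :
  cycle_on S s -> x \in S -> y \in S -> x != y -> single_cycle s.
Proof.
move=> [fixS cardS] xS yS xy.
have S2 : 1 < #|S| by rewrite (cardsD1 x) xS (cardsD1 y) !inE eq_sym xy yS.
have Fge : #|~: S| <= #|[set z | s z == z]|.
  by apply/subset_leq_card/subsetP=> z; rewrite !inE => /fixS/eqP.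
have N_gt0 : 0 < #|[set C in porbits s | 1 < #|C|]|.
  rewrite lt0n cards_eq0; apply: contraTneq S2 => N0.
  have fixT : [set z | s z == z] = setT.
    apply/setP=> z; rewrite !inE; apply/eqP.
    have := in_set0 (porbit s z); rewrite -N0 inE imset_f //= ltnNge => /negbFE.
    by move=> /card_le1_eqP; apply; [apply: porbit_id | apply: (mem_porbit s 1)].
  move: cardS; rewrite card_porbits fixT N0 cards0 cardsT add0n -addn1.
  by move=> /addnI->.
move: cardS N_gt0; rewrite card_porbits /single_cycle -(cardsC S).
move: #|[set C in _ | _]| #|[set z | _]| Fge => N F; move: #|~: S| #|S| => c m.
by move=> ? ? ?; apply/eqP; lia.
Qed.
End Cycles.

(** * Conjugating one perfect matching to another *)

(** A perfect matching of [T], seen as the involution exchanging the two ends of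
each edge. *)
Definition matching (T : finType) (f : {perm T}) : Prop :=
  (forall x, f x != x) /\ involutive f.

Section Matchings.
Variable T : finType.
Implicit Types (f g h : {perm T}) (a b c d p q : T).

Lemma matchingJ f h : matching f -> matching (f ^ h).
Proof.
move=> [f_neq fK]; split=> x; rewrite -[x](permKV h) !permJ.
  by rewrite (inj_eq perm_inj).
by rewrite fK.
Qed.

Lemma tperm_commute_disjoint a b c d :
  a != c -> a != d -> b != c -> b != d ->
  tperm a b * tperm c d = tperm c d * tperm a b.
Proof.
by move=> ac ad bc bd; rewrite conjgC tpermJ !tpermD // eq_sym.
Qed.

Lemma conj_tperm_edge f a : matching f -> f ^ tperm a (f a) = f.
Proof.
move=> [_ fK]; apply/conjg_fixP/commgP/commute_sym/commgP/conjg_fixP.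
by rewrite tpermJ fK tpermC.
Qed.

Lemma conj_tperm_edges f a b :
  matching f -> a != b -> a != f b -> f ^ (tperm a b * tperm (f a) (f b)) = f.
Proof.
move=> [f_neq fK] ab afb.
apply/conjg_fixP/commgP/commute_sym/commgP/conjg_fixP.
have fab : f a != b by apply: contraNneq afb => <-; rewrite fK.
by rewrite conjMg !tpermJ !fK tperm_commute_disjoint // 1?eq_sym.
Qed.

(** The edges [a, f a] and [b, f b] are replaced by [b, f a] and [a, f b] in either
case: the two transpositions differ by the exchange of the two edges, which
preserves [f]. *)
Lemma conj_tperm_other f a b :
  matching f -> a != b -> a != f b -> f ^ tperm (f a) (f b) = f ^ tperm a b.
Proof.
move=> mf ab afb; rewrite -{1}(conj_tperm_edges mf ab afb) !conjgM.
by rewrite -(conjgM (f ^ tperm a b)) tperm2 conjg1.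
Qed.

(** The [5]-cycle sending [q] to [a], [a] to [p], [p] to [c], [c] to [b] and [b] to
[q].  Like [tperm b c], it turns the edges [a b], [c d] into [a c], [b d] and keeps
[p q], but it also visits [q], so that it can be attached to a cycle through [q].
It is [tperm b c] preceded by permutations that preserve [f]. *)
Lemma conj_5cycle f a c q :
  let b := f a in let d := f c in let p := f q in
  matching f -> uniq [:: a; b; c; d; p; q] ->
  f ^ (tperm q a * tperm q p * tperm q c * tperm q b) = f ^ tperm b c.
Proof.
move=> b d p mf; rewrite /= !inE !negb_or -!andbA.
case/and5P=> ab _ _ ap /and5P[aq bc _ bp /and5P[bq _ cp cq /and4P[_ _ pq _]]].
have -> : tperm q a * tperm q p * tperm q c * tperm q b =
          tperm a b * (tperm q a * tperm p b) * tperm b c.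
  have -> : tperm a b * (tperm q a * tperm p b) * tperm b c =
            tperm a b * tperm q a * tperm p b * tperm b c by rewrite !mulgA.
  rewrite [tperm a b * _]conjgC tpermJ tpermR (tpermD _ ab) 1?eq_sym // -!mulgA.
  congr (_ * _).
  rewrite [RHS]mulgA [tperm q b * _]conjgCV tpermV tpermJ tpermR.
  rewrite tpermD // 1?eq_sym //.
  rewrite -[RHS]mulgA [tperm q b * _]conjgCV tpermV tpermJ tpermR.
  rewrite (tpermD _ bc) 1?eq_sym //.
  by rewrite [tperm p q]tpermC.
rewrite conjgM; congr (_ ^ _); rewrite conjgM conj_tperm_edge //.
by apply: conj_tperm_edges => //; rewrite eq_sym.
Qed.

(** Induction on the number of points where [f] and [f'] differ.  Let [a] be such a
point, [b := f a], [c := f' a], [d := f c].  The matching [g := f ^ tperm b c] has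
the edges [a c], [b d] in place of the edges [a b], [c d] of [f], so that it agrees
with [f'] at [a] and [c].  If [h] solves the problem for [g] and [f'], then [u * h]
carries [f] to [f'] for any [u] with [f ^ u = g], and it is still a cycle as long as
[u] is a cycle sharing exactly one point with the cycle [h].
- If [f' b != d], then [b] and [d] are still points where [g] and [f'] differ, and
  [h] skips at most one of them.  A 3-cycle [u] through [a], [c] and one of the two
  that is not skipped works.
- If [f' b = d], then [a], [b], [c], [d] form a whole alternating circuit, which
  disappears from the differences of [g] and [f'].  The circuit is attached to the
  cycle [h] through the skipped point [p], by a 5-cycle through [p] and [f p], and
  [d] is skipped instead.  If [g = f'], a 3-cycle is enough. *)
Lemma matching_conj_cycle f f' :
  matching f -> matching f' -> f != f' ->
  exists2 p, f p != f' p & exists h,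
    [/\ f ^ h = f', ~~ odd_perm h
      & cycle_on [set x | (f x != f' x) && (x != p)] h].
Proof.
move: {2}_.+1 (ltnSn #|[set x | f x != f' x]|) => n.
elim: n f => // n IHn f; rewrite ltnS => le_n mf mf' neq_f.
have [a fa_neq]: exists a, f a != f' a.
  by apply/existsP; apply: contraR neq_f => /existsPn H; apply/eqP/permP => x;
    apply/eqP/negPn/H.
have [f_neq fK] := mf; have [f'_neq f'K] := mf'.
pose b := f a; pose c := f' a; pose d := f c.
have ba : b != a by exact: f_neq.
have ca : c != a by exact: f'_neq.
have bc : b != c by exact: fa_neq.
have dc : d != c by exact: f_neq.
have da : d != a by apply: contraNneq bc => da; rewrite /b -da fK.
have db : d != b by rewrite (inj_eq perm_inj).
pose g := f ^ tperm b c.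
have mg : matching g by apply: matchingJ.
have gE x : g x = tperm b c (f (tperm b c x)).
  by rewrite /g conjgE tpermV !permM.
have ga : g a = c by rewrite gE (tpermD ba ca) -/b tpermL.
have gc : g c = a by rewrite gE tpermR /b fK tpermD.
have gb : g b = d by rewrite gE tpermL -/d tpermD // eq_sym.
have td : tperm b c d = d by rewrite tpermD // eq_sym.
have gd : g d = b by rewrite gE td /d fK tpermR.
have gx x : x \notin [:: a; b; c; d] -> g x = f x.
  rewrite !inE !negb_or => /and4P[xa xb xc xd].
  have tx : tperm b c x = x by rewrite tpermD // eq_sym.
  rewrite gE tx tpermD //; first by rewrite (inj_eq perm_inj) eq_sym.
  by apply: contraNneq xd => E; rewrite /d E fK.
have f'c : f' c = a by rewrite /c f'K.
have DE x : (f x != f' x) = (x \in [:: a; b; c; d]) || (g x != f' x).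
  have [|/gx->//] := boolP (x \in [:: a; b; c; d]).
  rewrite !inE => /or4P[] /eqP->.
  - exact: fa_neq.
  - by rewrite /b fK; apply: contraNneq bc => E; rewrite /c {1}E f'K.
  - by rewrite f'c da.
  - by rewrite /d fK eq_sym; apply: contraNneq da => E; rewrite -f'c -E f'K.
have ga' : g a = f' a by [].
have gc' : g c = f' c by rewrite gc f'c.
have lt_g : #|[set x | g x != f' x]| < n.
  apply: leq_trans le_n; apply/proper_card/properP; split.
    by apply/subsetP=> x; rewrite !inE DE orbC => ->.
  by exists a; rewrite !inE ?ga ?eqxx.
have [eq_g|neq_g] := eqVneq g f'.
  (* A single circuit of length 4, and the 3-cycle on [a], [b], [c]. *)
  exists d; first by rewrite DE !inE eqxx !orbT.
  exists (tperm b a * (tperm b c * 1)); split.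
  - by rewrite mulg1 tpermC conjgM conj_tperm_edge.
  - by rewrite !odd_mul_tperm ba bc odd_perm1.
  have -> : [set x | (f x != f' x) && (x != d)] = a |: (c |: [set b]).
    apply/setP=> x; rewrite !inE DE eq_g eqxx orbF !inE.
    have [->|] := eqVneq x d; last by rewrite andbT orbF orbCA orbC -orbA.
    by rewrite (negPf da) (negPf db) (negPf dc) andbF.
  apply: cycle_on_tperm; rewrite ?inE ?eqxx ?orbT //.
    by apply: cycle_on_tperm; rewrite ?inE ?eqxx // 1?eq_sym //; apply: cycle_on1.
  by rewrite !negb_or ![a == _]eq_sym ca ba.
have [p gp [h [gh odd_h cyc_h]]] := IHn g lt_g mg mf' neq_g.
have Dp : f p != f' p by rewrite DE gp orbT.
have pa : p != a by apply: contraNneq gp => ->; apply/eqP.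
have pc : p != c by apply: contraNneq gp => ->; apply/eqP.
have [f'b|f'b] := eqVneq (f' b) d.
  (* The 5-cycle meets the cycle [h] in [q] only; it inserts [p], [a], [b], [c]. *)
  have f'd : f' d = b by rewrite -f'b f'K.
  have pb : p != b by apply: contraNneq gp => ->; rewrite gb f'b.
  have pd : p != d by apply: contraNneq gp => ->; rewrite gd f'd.
  have gpE : g p = f p by apply: gx; rewrite !inE !negb_or pa pb pc.
  pose q := f p.
  have fq : f q = p by rewrite /q fK.
  have qa : q != a by apply: contraNneq pb; rewrite -fq => ->.
  have qb : q != b by rewrite (inj_eq perm_inj).
  have qc : q != c by apply: contraNneq pd; rewrite -fq => ->.
  have qd : q != d by rewrite (inj_eq perm_inj).
  have qp : q != p by exact: f_neq.
  have gq : g q = p by rewrite /q -gpE; case: mg.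
  have Dq : g q != f' q.
    by apply: contraNneq gp; rewrite gq => E; rewrite gpE -/q E f'K.
  exists d; first by rewrite DE !inE eqxx !orbT.
  exists (tperm q a * (tperm q p * (tperm q c * (tperm q b * h)))); split.
  - rewrite !mulgA conjgM -fq conj_5cycle // /= fq !inE !negb_or -/b -/d.
    by do ![apply/andP; split] => //; rewrite eq_sym.
  - by rewrite !odd_mul_tperm qa qb qc qp /= !negbK.
  have -> : [set x | (f x != f' x) && (x != d)] =
    a |: (p |: (c |: (b |: [set x | (g x != f' x) && (x != p)]))).
    apply/setP=> x; rewrite !inE DE !inE.
    have [->|_] := eqVneq x d; last first.
      have [->|_] := eqVneq x p; first by rewrite gp !orbT.
      by rewrite !andbT orbF -!orbA orbCA; do !bool_congr.
    rewrite gd f'd eqxx [d == p]eq_sym (negPf pd) (negPf da) (negPf db).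
    by rewrite (negPf dc) !andbF.
  set S := [set x | _ && (x != p)].
  have notS : [&& a \notin p |: (c |: (b |: S)), p \notin c |: (b |: S),
                  c \notin b |: S & b \notin S].
    rewrite !inE ga' gc' gb f'b !eqxx !andbF !orbF !negb_or /= ?andbT.
    by do ![apply/andP; split] => //; rewrite eq_sym.
  case/and4P: notS => aS pS cS bS.
  by do !apply: cycle_on_tperm => //; rewrite !inE Dq qp ?orbT.
have [pb|pb] := eqVneq p b.
  (* As [b] is skipped by [h], the 3-cycle is attached at [d]. *)
  have Dd : g d != f' d.
    by rewrite gd; apply: contraNneq f'b => ->; rewrite f'K.
  exists b; first by rewrite -pb.
  exists (tperm d c * (tperm d a * h)); split.
  - rewrite [tperm d c]tpermC conjgM conj_tperm_edge // conjgM [tperm d a]tpermC.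
    by rewrite -conj_tperm_other ?fK // 1?eq_sym // /d fK.
  - by rewrite !odd_mul_tperm dc da /= negbK.
  have -> : [set x | (f x != f' x) && (x != b)] =
    c |: (a |: [set x | (g x != f' x) && (x != p)]).
    apply/setP=> x; rewrite pb !inE DE !inE.
    have [->|_] := eqVneq x b.
      by rewrite !andbF (negPf bc) (negPf ba).
    have [->|_] := eqVneq x d; first by rewrite Dd !orbT.
    by case: (x == a); case: (x == c); rewrite ?orbT ?andbT ?orbF.
  apply: cycle_on_tperm; first apply: cycle_on_tperm => //.
  - by rewrite !inE Dd pb db.
  - by rewrite !inE ga' eqxx.
  - by rewrite !inE Dd pb db !orbT.
  - by rewrite !inE gc' eqxx orbF.
(* The 3-cycle is attached at [b]. *)
have Db : g b != f' b by rewrite gb eq_sym.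
exists p => //; exists (tperm b a * (tperm b c * h)); split.
- by rewrite [tperm b a]tpermC conjgM conj_tperm_edge // conjgM.
- by rewrite !odd_mul_tperm ba bc /= negbK.
have -> : [set x | (f x != f' x) && (x != p)] =
  a |: (c |: [set x | (g x != f' x) && (x != p)]).
  apply/setP=> x; rewrite !inE DE !inE.
  have [->|_] := eqVneq x b; first by rewrite Db [b == p]eq_sym pb !orbT.
  have [->|_] := eqVneq x d.
    have bf'd : b != f' d by apply: contraNneq f'b => ->; rewrite f'K.
    by rewrite gd bf'd (negPf da) (negPf dc) !orbT.
  have [->|_] := eqVneq x p; first by rewrite !andbF (negPf pa) (negPf pc).
  by rewrite !andbT !orbF -!orbA.
apply: cycle_on_tperm; first apply: cycle_on_tperm => //.
- by rewrite !inE Db eq_sym pb.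
- by rewrite !inE gc' eqxx.
- by rewrite !inE Db [b == p]eq_sym pb !orbT.
- by rewrite !inE ga' eqxx orbF eq_sym.
Qed.

(** The even cycle of [matching_conj_cycle] skips a point [p] and contains [f p];
multiplying by the edge [tperm (f p) p], which preserves [f], inserts [p] and
changes the parity. *)
Lemma matching_conj_single_cycle f f' (odd_b : bool) :
  matching f -> matching f' -> f != f' ->
  exists h, [/\ f ^ h = f', odd_perm h = odd_b & single_cycle h].
Proof.
move=> mf mf' neq_f.
have [p Dp [h [fh odd_h cyc_h]]] := matching_conj_cycle mf mf' neq_f.
have [[f_neq fK] [f'_neq f'K]] := (mf, mf').
have Dfp : f (f p) != f' (f p).
  by rewrite fK; apply: contraNneq Dp => E; rewrite {2}E f'K.
have Df'p : f (f' p) != f' (f' p).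
  by rewrite f'K; apply: contraNneq Dp => E; rewrite -{1}E fK.
case: odd_b.
  exists (tperm (f p) p * h); split.
  - by rewrite tpermC conjgM conj_tperm_edge.
  - by rewrite odd_mul_tperm f_neq (negPf odd_h).
  apply: (single_cycle_on (x := f p) (y := p)); last exact: f_neq.
  - by apply: cycle_on_tperm cyc_h _ _; rewrite inE ?Dfp ?f_neq ?eqxx ?andbF.
  - by rewrite !inE Dfp f_neq orbT.
  - by rewrite !inE eqxx.
exists h; split=> //; first exact: negPf.
by apply: (single_cycle_on cyc_h _ _ Dp); rewrite inE ?Dfp ?Df'p ?f_neq ?f'_neq.
Qed.
End Matchings.

(** * The group of even permutations commuting with the swap *)

Section EvenHyperoctahedral.
Variable k : nat.
Implicit Types (s : 'S_(k + k)) (x : 'I_(k + k)) (i : 'I_k).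

Definition swap_ord x : 'I_(k + k) :=
  match split x with inl i => rshift k i | inr i => lshift k i end.

Lemma swap_ordK : involutive swap_ord.
Proof.
have El i : split (lshift k i) = inl i by exact: unsplitK (inl i).
have Er i : split (rshift k i) = inr i by exact: unsplitK (inr i).
by move=> x; rewrite /swap_ord; case: (split_ordP x) => i ->; rewrite ?El ?Er.
Qed.

Definition swap : 'S_(k + k) := perm (inv_inj swap_ordK).

Lemma swap_l i : swap (lshift k i) = rshift k i.
Proof. by rewrite permE /swap_ord (unsplitK (inl i)). Qed.

Lemma swap_r i : swap (rshift k i) = lshift k i.
Proof. by rewrite permE /swap_ord (unsplitK (inr i)). Qed.

Lemma matching_swap : matching swap.
Proof.
split=> x; last by rewrite !permE swap_ordK.
by case: (split_ordP x) => i ->; rewrite ?swap_l ?swap_r ?eq_rlshift ?eq_lrshift.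
Qed.

Lemma conj_swapP s :
  reflect (forall i, s (rshift k i) = swap (s (lshift k i))) (swap ^ s == swap).
Proof.
have [_ swapK] := matching_swap.
apply: (iffP eqP) => [sws i|H].
  by rewrite -swap_l -permJ sws.
apply/permP=> x; rewrite -[x](permKV s) permJ.
move: (s^-1 x) => y.
by case: (split_ordP y) => i ->; rewrite ?swap_l ?swap_r H ?swapK.
Qed.

Lemma birkhoffHP s :
  s \in birkhoffH k <-> exists p : 'S_k,
    forall i, s (lshift k i) = lshift k (p i) /\ s (rshift k i) = rshift k (p i).
Proof.
rewrite inE; split=> [/existsP[p /eqP Es]|[p Hp]].
  exists p => i; split; apply/eqP.
    have /matrixP/(_ (lshift k i) (lshift k (p i))) := Es.
    by rewrite block_mxEul !mxE eqxx; case: eqP.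
  have /matrixP/(_ (rshift k i) (rshift k (p i))) := Es.
  by rewrite block_mxEdr !mxE eqxx; case: eqP.
apply/existsP; exists p; apply/eqP/matrixP => x y.
case: (split_ordP x) => i ->; case: (split_ordP y) => j ->;
  rewrite ?block_mxEul ?block_mxEur ?block_mxEdl ?block_mxEdr !mxE;
  have [sl sr] := Hp i; rewrite ?sl ?sr.
- by rewrite eq_lshift.
- by rewrite eq_lrshift.
- by rewrite eq_rlshift.
- by rewrite eq_rshift.
Qed.

Lemma birkhoffH_even s : s \in birkhoffH k -> ~~ odd_perm s.
Proof.
rewrite inE => /existsP[p /eqP Es].
have := det_perm int s; rewrite Es det_ublock det_perm -GRing.signr_addb addbb.
by case: (odd_perm s).
Qed.

(** Adding the second block column to the first, then subtracting the first block
row from the second, leaves a block triangular matrix whose diagonal blocks are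
[1] and [1 - 2 D]. *)
Lemma det_diag_flips (d : 'rV[bool]_k) :
  (\det (block_mx (1%:M - diag01 d) (diag01 d) (diag01 d) (1%:M - diag01 d))
   = (-1) ^+ (\sum_i d ord0 i)%N)%R.
Proof.
set D := diag01 d; set A := block_mx _ _ _ _.
have AD : (block_mx 1%:M 0 (- 1%:M) 1%:M *m (A *m block_mx 1%:M 0 1%:M 1%:M)
           = block_mx 1%:M D 0 (1%:M - D - D) :> 'M[int]_(k + k))%R.
  rewrite !mulmx_block !mulmx1 !mul1mx !mul0mx !mulmx0 !mulNmx !mul1mx.
  rewrite !(GRing.add0r, GRing.addr0) (GRing.addrC (- D)%R) (GRing.addrC D).
  have -> : (1%:M - D + D = 1%:M :> 'M[int]_k)%R by exact: GRing.subrK.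
  by rewrite GRing.addNr.
have := congr1 determinant AD.
rewrite !det_mulmx !det_lblock det_ublock !det1 !GRing.mul1r !GRing.mulr1 => ->.
have -> : (1%:M - D - D = diag_mx (\row_i (-1) ^+ d ord0 i) :> 'M[int]_k)%R.
  apply/matrixP=> i j; rewrite !mxE.
  by case: (i == j); case: (d ord0 _).
rewrite det_diag -GRing.prodrXr.
by apply: eq_bigr => i _; rewrite mxE.
Qed.

Lemma tr_diag01 (d : 'rV[bool]_k) : (\tr (diag01 d) = (\sum_i d ord0 i)%N%:Z)%R.
Proof.
rewrite mxtrace_diag (big_morph Posz PoszD erefl); apply: eq_bigr => i _.
by rewrite mxE; case: (d _ i).
Qed.

(** An element of [birkhoffK k] flips the pairs selected by a boolean vector [d].  The
condition on the trace amounts to evenness: the trace of [D] is the number of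
flips, whose parity is read on the determinant. *)
Lemma birkhoffKP s :
  s \in birkhoffK k <-> ~~ odd_perm s /\
    exists d : 'I_k -> bool, forall i,
      s (lshift k i) = (if d i then rshift k i else lshift k i) /\
      s (rshift k i) = (if d i then lshift k i else rshift k i).
Proof.
have matP (d : 'rV[bool]_k) :
  perm_mx s = block_mx (1%:M - diag01 d) (diag01 d) (diag01 d) (1%:M - diag01 d)
    :> 'M[int]_(k + k)
  <-> forall i,
      s (lshift k i) = (if d ord0 i then rshift k i else lshift k i) /\
      s (rshift k i) = (if d ord0 i then lshift k i else rshift k i).
  split=> [Es i|Hs].
    split; apply/eqP.
      have /matrixP/(_ (lshift k i) (if d ord0 i then rshift k i else lshift k i)) := Es.
      case di: (d ord0 i); rewrite ?block_mxEul ?block_mxEur !mxE eqxx di; by case: eqP.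
    have /matrixP/(_ (rshift k i) (if d ord0 i then lshift k i else rshift k i)) := Es.
    case di: (d ord0 i); rewrite ?block_mxEdl ?block_mxEdr !mxE eqxx di; by case: eqP.
  apply/matrixP=> x y.
  case: (split_ordP x) => i ->; case: (split_ordP y) => j ->;
    rewrite ?block_mxEul ?block_mxEur ?block_mxEdl ?block_mxEdr !mxE;
    have [sl sr] := Hs i; rewrite ?sl ?sr; case: (d ord0 i);
    rewrite ?eq_lshift ?eq_rshift ?eq_lrshift ?eq_rlshift; by case: eqP.
have parity (d : 'rV[bool]_k) :
  perm_mx s = block_mx (1%:M - diag01 d) (diag01 d) (diag01 d) (1%:M - diag01 d)
    :> 'M[int]_(k + k)
  -> (2 %| (\tr (diag01 d))%R)%Z = ~~ odd_perm s.
  move=> Es; have := det_perm int s; rewrite Es det_diag_flips tr_diag01.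
  rewrite -GRing.signr_odd => sgn.
  rewrite -[(2 %| _)%Z]/(2 %| \sum_i d ord0 i) dvdn2.
  by move: sgn; case: odd; case: odd_perm.
rewrite inE; split=> [/existsP[d /andP[ev /eqP Es]]|[ev [d Hs]]].
  split; first by rewrite -(parity d).
  by exists (d ord0); apply/matP.
have Es : forall i,
      s (lshift k i) = (if (\row_j d j)%R ord0 i then rshift k i else lshift k i) /\
      s (rshift k i) = (if (\row_j d j)%R ord0 i then lshift k i else rshift k i).
  by move=> i; rewrite mxE.
apply/existsP; exists (\row_j d j)%R; move/matP: Es => Es.
by rewrite /= (parity _ Es) ev Es eqxx.
Qed.

(** A permutation [s] commuting with [swap] permutes the pairs [j, j + k], through
some [p]; the corresponding [h] in [birkhoffH k] is even, being made of two copies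
of [p], and [h^-1 * s] preserves every pair, so it lies in [birkhoffK k] if and only
if [s] is even. *)
Lemma birkhoffGE s : (s \in birkhoffG k) = ~~ odd_perm s && (swap ^ s == swap).
Proof.
apply/idP/andP=> [/mulsgP[h t Hh Kt ->]|[ev_s /conj_swapP sws]].
  move: (Kt) => /birkhoffKP[ev_t [d Hd]].
  rewrite odd_permM (negPf (birkhoffH_even Hh)) (negPf ev_t); split=> //.
  have [p Hp] := (birkhoffHP h).1 Hh.
  apply/conj_swapP=> i; rewrite !permM (Hp i).1 (Hp i).2 (Hd _).1 (Hd _).2.
  by case: (d _); rewrite ?swap_l ?swap_r.
(* The index of the pair containing a given point. *)
pose pr x : 'I_k := match split x with inl i => i | inr i => i end.
have pr_l i : pr (lshift k i) = i by rewrite /pr (unsplitK (inl i)).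
have pr_r i : pr (rshift k i) = i by rewrite /pr (unsplitK (inr i)).
have prP x : x = lshift k (pr x) \/ x = rshift k (pr x).
  by case: (split_ordP x) => i ->; rewrite ?pr_l ?pr_r; [left|right].
have pr_inj : injective (fun i => pr (s (lshift k i))).
  move=> i j /= Epr.
  suff [/perm_inj/lshift_inj//|E] :
    s (lshift k i) = s (lshift k j) \/ s (lshift k i) = s (rshift k j).
    by move/perm_inj/eqP: E; rewrite eq_lrshift.
  rewrite sws; case: (prP (s (lshift k i))) (prP (s (lshift k j))) => -> [] ->;
    by rewrite Epr ?swap_l ?swap_r; auto.
pose p := perm pr_inj.
pose hf x := match split x with inl i => lshift k (p i) | inr i => rshift k (p i) end.
have hf_l i : hf (lshift k i) = lshift k (p i) by rewrite /hf (unsplitK (inl i)).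
have hf_r i : hf (rshift k i) = rshift k (p i) by rewrite /hf (unsplitK (inr i)).
have hf_inj : injective hf.
  move=> x y; case: (split_ordP x) => i ->; case: (split_ordP y) => j ->;
    rewrite ?hf_l ?hf_r.
  - by move/lshift_inj/perm_inj->.
  - by move/eqP; rewrite eq_lrshift.
  - by move/eqP; rewrite eq_rlshift.
  - by move/rshift_inj/perm_inj->.
pose h := perm hf_inj.
have Hh : h \in birkhoffH k.
  by apply/birkhoffHP; exists p => i; rewrite !(permE hf_inj) hf_l hf_r.
rewrite -[s](mulKVg h); apply: mem_mulg => //; apply/birkhoffKP; split.
  by rewrite odd_permM odd_permV (negPf (birkhoffH_even Hh)).
exists (fun j => (h^-1 * s) (lshift k j) == rshift k j) => j.
have [i ->] : exists i, j = p i by exists (p^-1 j); rewrite permKV.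
have -> : (h^-1 * s) (lshift k (p i)) = s (lshift k i).
  by rewrite -hf_l -(permE hf_inj) permM permK.
have -> : (h^-1 * s) (rshift k (p i)) = swap (s (lshift k i)).
  by rewrite -hf_r -(permE hf_inj) permM permK sws.
have := prP (s (lshift k i)).
have -> : pr (s (lshift k i)) = p i by rewrite permE.
by case=> ->; rewrite ?eqxx ?eq_lrshift ?swap_l ?swap_r.
Qed.
End EvenHyperoctahedral.

(** * Maximality of the independent set *)

Theorem theorem3p5 (k : nat) (hn : 4 <= k + k) :
  maximal_independent (@birkhoff_adj (k + k)) (birkhoffG k).
Proof.
split=> [s t|t tG].
  (* The fixed points of [s^-1 * t] in the two halves correspond under [swap]. *)
  rewrite !birkhoffGE => /andP[ev_s /eqP sw_s] /andP[ev_t /eqP sw_t] _.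
  rewrite /birkhoff_adj; set g := s^-1 * t.
  have ev_g : ~~ odd_perm g by rewrite odd_permM odd_permV (negPf ev_s).
  have sw_g : swap k ^ g = swap k by rewrite conjgM -{1}sw_s conjgK.
  apply: contraNN ev_g => /single_cycle_odd->.
  rewrite card_ord oddD addbb addFb -sum1_card big_split_ord /=.
  have -> : \sum_(i < k | rshift k i \in [set x | g x == x]) 1 =
            \sum_(i < k | lshift k i \in [set x | g x == x]) 1.
    apply: eq_bigl => i; rewrite !inE -swap_l.
    by rewrite -permJ sw_g (inj_eq perm_inj).
  by rewrite oddD addbb.
suff [h [gG cyc_h]] : exists h, t * h^-1 \in birkhoffG k /\ single_cycle h.
  move=> /(_ (t * h^-1) t); rewrite !inE gG orbT eqxx => /(_ isT isT).
  rewrite /birkhoff_adj invMg invgK mulgKV cyc_h => H.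
  suff /H : t * h^-1 != t by [].
  by apply: contraNneq tG => <-.
move: tG; rewrite birkhoffGE negb_and negbK.
have [sw_t|sw_t _] := eqVneq (swap k ^ t) (swap k).
  rewrite orbF => odd_t.
  have k_gt0 : 0 < k by move: hn; case: (k).
  pose x := lshift k (Ordinal k_gt0); pose y := swap k x.
  have xy : x != y by rewrite eq_sym (matching_swap k).1.
  exists (tperm x y); rewrite birkhoffGE tpermV odd_permM odd_tperm xy odd_t.
  rewrite conjgM sw_t.
  rewrite conj_tperm_edge ?eqxx; last exact: matching_swap; split=> //.
  apply: (single_cycle_on (S := y |: [set x]) (x := x) (y := y));
    rewrite ?inE ?eqxx ?orbT //.
  rewrite -[tperm x y]mulg1; apply: cycle_on_tperm; rewrite ?inE ?eqxx // 1?eq_sym //.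
  exact: cycle_on1.
have sw_t' : swap k != swap k ^ t by rewrite eq_sym.
have mt : matching (swap k ^ t) by apply: matchingJ; apply: matching_swap.
have [h [sw_h odd_h cyc_h]] :=
  matching_conj_single_cycle (odd_perm t) (matching_swap k) mt sw_t'.
exists h; rewrite birkhoffGE odd_permM odd_permV odd_h addbb conjgM.
by rewrite -sw_h conjgK eqxx.
Qed.
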